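(* Let $\omega:\Pi(\mathbf{x})\to\Pi(\mathbf{x})$ be the linear map with $\omega(e_\pi)=h_\pi$ for all set partitions $\pi$. Then: (i) $\omega$ is an involution; (ii) each $p_\pi$ is an eigenvector of $\omega$ with eigenvalue $(-1)^\pi$; (iii) $\omega\rho=\rho\omega$, where on the left $\omega$ denotes the usual involution of the ordinary symmetric functions $\Lambda(\mathbf x)$ (the linear map with $\omega(e_\lambda)=h_\lambda$) and $\rho$ is the projection letting the variables commute.
   Context: $\Pi(\mathbf{x})$ is the algebra of elements of bounded degree in $\mathbb{Q}\langle\langle x_1,x_2,\ldots\rangle\rangle$ (formal power series in noncommuting variables) invariant under all permutations of the variables; $\rho:\mathbb{Q}\langle\langle x_1,x_2,\ldots\rangle\rangle\to\mathbb{Q}[[x_1,x_2,\ldots]]$ lets the variables commute. For a set partition $\pi$ of $[n]$, with sums over $n$-tuples $(i_1,\dots,i_n)$ of positive integers: $p_\pi=\sum x_{i_1}\cdots x_{i_n}$ over tuples with $i_j=i_k$ whenever $j,k$ lie in the same block of $\pi$; $e_\pi=\sum x_{i_1}\cdots x_{i_n}$ over tuples with $i_j\neq i_k$ whenever $j\ne k$ lie in the same block. For $f:[n]\to\{x_1,x_2,\ldots\}$ let $\ker f$ be the set partition whose blocks are the nonempty fibers of $f$, and $M_f=f(1)\cdots f(n)$. Then $h_\pi=\sum_{(f,L)}M_f$ over all pairs with $f:[n]\to\{x_1,x_2,\dots\}$ and $L$ a choice of linear ordering of the elements of each block of $(\ker f)\wedge\pi$ (meet in the refinement order). The $e_\pi$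 (over all $n\ge0$ and $\pi$) form a basis of $\Pi(\mathbf x)$. The sign $(-1)^\pi$ is the sign of any permutation whose cycles are the blocks of $\pi$. *)

(* Defs.v *)
From HB Require Import structures.
From mathcomp Require Import all_boot all_order all_algebra all_fingroup.
From mathcomp Require Import finmap multiset.
From mathcomp Require Import boolp classical_sets functions cardinality fsbigop.

Set Implicit Arguments.
Unset Strict Implicit.
Unset Printing Implicit Defensive.

Import GRing.Theory.

Local Open Scope mset_scope.
Local Open Scope ring_scope.

(* The variables x_1, x_2, ... are indexed by nat (x_(i+1) is the letter i).
   A word in the variables is a [seq nat], a commutative monomial is the finite
   multiset of its letters, and a power series is its coefficient function.
   The aliases inherit only the pointwise vector space structure, since the
   pointwise product of functions is not the product of series. *)
Definition ncseries := seq nat -> rat.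
Definition cseries := {mset nat} -> rat.

HB.instance Definition _ := GRing.Lmodule.copy ncseries (seq nat -> rat^o).
HB.instance Definition _ := GRing.Lmodule.copy cseries ({mset nat} -> rat^o).

(* The formal sum of the monomials [mon t], t ranging over [A].  All uses below
   have finitely many t for each monomial, so the sum is a genuine one. *)
Definition monsum (T : choiceType) (M : Type) (A : set T) (mon : T -> M) :
    M -> rat :=
  fun m => \sum_(t \in [set t | A t /\ mon t = m]%classic) (1 : rat).

Definition rename (s : nat -> nat) (m : {mset nat}) : {mset nat} :=
  seq_mset (map s m).

Definition nc_invariant (F : ncseries) : Prop :=
  forall s : nat -> nat, bijective s -> forall w, F (map s w) = F w.

Definition nc_bounded (F : ncseries) : Prop :=
  exists d, forall w, (d < size w)%N -> F w = 0.

Definition c_invariant (F : cseries) : Prop :=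
  forall s : nat -> nat, bijective s -> forall m, F (rename s m) = F m.

Definition c_bounded (F : cseries) : Prop :=
  exists d, forall m : {mset nat}, (d < size m)%N -> F m = 0.

Definition in_ncsym : {pred ncseries} :=
  fun F => `[< nc_invariant F /\ nc_bounded F >].

Definition in_sym : {pred cseries} :=
  fun F => `[< c_invariant F /\ c_bounded F >].

Fact in_ncsym_submod : submod_closed in_ncsym.
Proof.
split; first by apply/asboolP; split=> //; exists 0%N.
move=> a F G /asboolP[iF [d bF]] /asboolP[iG [e bG]]; apply/asboolP; split.
  move=> s bs w.
  by change (a * F (map s w) + G (map s w) = a * F w + G w); rewrite iF ?iG.
exists (maxn d e) => w; rewrite gtn_max => /andP[dw ew].
by change (a * F w + G w = 0); rewrite bF ?bG ?mulr0 ?addr0.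
Qed.

Fact in_sym_submod : submod_closed in_sym.
Proof.
split; first by apply/asboolP; split=> //; exists 0%N.
move=> a F G /asboolP[iF [d bF]] /asboolP[iG [e bG]]; apply/asboolP; split.
  move=> s bs w.
  change (a * F (rename s w) + G (rename s w) = a * F w + G w).
  by rewrite iF ?iG.
exists (maxn d e) => w; rewrite gtn_max => /andP[dw ew].
by change (a * F w + G w = 0); rewrite bF ?bG ?mulr0 ?addr0.
Qed.

HB.instance Definition _ :=
  GRing.isSubmodClosed.Build rat ncseries in_ncsym in_ncsym_submod.
HB.instance Definition _ :=
  GRing.isSubmodClosed.Build rat cseries in_sym in_sym_submod.

Record NCSym := MkNCSym { ncsym_val :> ncseries; _ : ncsym_val \in in_ncsym }.
HB.instance Definition _ := [isSub for ncsym_val].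
HB.instance Definition _ := [Choice of NCSym by <:].
HB.instance Definition _ := [SubChoice_isSubLmodule of NCSym by <:].

Record Sym := MkSym { sym_val :> cseries; _ : sym_val \in in_sym }.
HB.instance Definition _ := [isSub for sym_val].
HB.instance Definition _ := [Choice of Sym by <:].
HB.instance Definition _ := [SubChoice_isSubLmodule of Sym by <:].

Lemma monsum_reindex (T : choiceType) (M : Type) (A : set T) (mon : T -> M)
    (g h : T -> T) (m m' : M) :
  cancel g h -> cancel h g -> (forall t, A t -> A (g t)) ->
  (forall t, A t -> A (h t)) -> (forall t, mon t = m <-> mon (g t) = m') ->
  monsum A mon m' = monsum A mon m.
Proof.
move=> gK hK Ag Ah gm; rewrite /monsum.
rewrite (@reindex_fsbig _ _ _ _ _ g [set t | A t /\ mon t = m]%classic) //.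
split.
- by move=> t /= [At mt]; split; [exact: Ag | exact/gm].
- by move=> t u _ _ /(congr1 h); rewrite !gK.
- move=> t /= [At mt]; exists (h t) => //=; split; first exact: Ah.
  by apply/gm; rewrite hK.
Qed.

Lemma monsum_eq0 (T : choiceType) (M : Type) (A : set T) (mon : T -> M) m :
  (forall t, A t -> mon t <> m) -> monsum A mon m = 0.
Proof.
move=> Am; rewrite /monsum (_ : [set _ | _]%classic = set0) ?fsbig_set0 //.
by apply/seteqP; split=> // t /= [/Am].
Qed.

Section SetPartitions.
Variable n : nat.
Implicit Types (P Q : {set {set 'I_n}}) (f : {ffun 'I_n -> nat}).

Definition setpart P : bool := finset.partition P [set: 'I_n]%SET.

Definition same_block P : rel 'I_n :=
  fun j k => [exists B in P, (j \in B) && (k \in B)].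

Definition part_ker f : {set {set 'I_n}} := preim_partition f [set: 'I_n]%SET.

Definition part_meet P Q : {set {set 'I_n}} :=
  ([set B :&: C | B in P, C in Q] :\ finset.set0)%SET.

Definition refines P Q : bool := [forall B in P, [exists C in Q, B \subset C]].

Lemma part_meetP P Q : setpart P -> setpart Q ->
  [/\ setpart (part_meet P Q), refines (part_meet P Q) P,
      refines (part_meet P Q) Q
    & forall R, setpart R -> refines R P -> refines R Q ->
        refines R (part_meet P Q)].
Proof.
move=> /and3P[/eqP cP tP _] /and3P[/eqP cQ tQ _]; split.
- apply/and3P; split; last by rewrite !inE eqxx.
    apply/eqP/setP=> x; rewrite inE; apply/bigcupP.
    have : x \in finset.cover P by rewrite cP inE.
    have : x \in finset.cover Q by rewrite cQ inE.
    move=> /bigcupP[C CQ xC] /bigcupP[B BP xB].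
    exists (B :&: C)%SET; rewrite !inE ?xB ?xC //.
    rewrite (imset2_f _ BP CQ) andbT; apply/set0Pn.
    by exists x; rewrite inE xB.
  apply/finset.trivIsetP=> X Y.
  rewrite !inE => /andP[_ /imset2P[B C BP CQ ->]].
  move=> /andP[_ /imset2P[B' C' BP' CQ' ->]] neq.
  rewrite -setI_eq0; apply/eqP/setP=> x; rewrite !inE.
  apply/negP=> /andP[/andP[xB xC] /andP[xB' xC']].
  move: neq; rewrite -(def_pblock tP BP xB) -(def_pblock tP BP' xB').
  by rewrite -(def_pblock tQ CQ xC) -(def_pblock tQ CQ' xC') eqxx.
- apply/forall_inP=> X; rewrite !inE => /andP[_ /imset2P[B C BP CQ ->]].
  by apply/exists_inP; exists B => //; exact: finset.subsetIl.
- apply/forall_inP=> X; rewrite !inE => /andP[_ /imset2P[B C BP CQ ->]].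
  by apply/exists_inP; exists C => //; exact: finset.subsetIr.
- move=> R /and3P[_ _ R0] /forall_inP RP /forall_inP RQ.
  apply/forall_inP=> X XR.
  have /exists_inP[B BP XB] := RP _ XR.
  have /exists_inP[C CQ XC] := RQ _ XR.
  have XBC : X \subset (B :&: C)%SET by rewrite finset.subsetI XB.
  apply/exists_inP; exists (B :&: C)%SET => //.
  rewrite !inE imset2_f // andbT; apply: contraNneq R0 => BC0.
  by move: XBC; rewrite BC0 finset.subset0 => /eqP <-.
Qed.

(* A linear ordering of a block is the duplicate-free list of its elements in
   increasing order; [::] is the dummy value off the blocks. *)
Definition block_orderings P : set {ffun {set 'I_n} -> seq 'I_n} :=
  [set L | forall B, if B \in P then perm_eq (L B) (enum B) else L B == [::]]%classic.

Definition ncmon f : seq nat := [seq f j | j <- enum 'I_n].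

Definition p_series P : ncseries :=
  monsum [set f : {ffun 'I_n -> nat} | forall j k, same_block P j k -> f j = f k]%classic ncmon.

Definition e_series P : ncseries :=
  monsum [set f : {ffun 'I_n -> nat} | forall j k, j != k -> same_block P j k -> f j <> f k]%classic
    ncmon.

Definition h_series P : ncseries :=
  monsum [set fL : {ffun 'I_n -> nat} * {ffun {set 'I_n} -> seq 'I_n} |
            block_orderings (part_meet (part_ker fL.1) P) fL.2]%classic
    (fun fL => ncmon fL.1).

Lemma size_ncmon f : size (ncmon f) = n.
Proof. by rewrite size_map size_enum_ord. Qed.

Definition ffrename (s : nat -> nat) f : {ffun 'I_n -> nat} :=
  [ffun j => s (f j)].

Lemma ncmon_ffrename s f : ncmon (ffrename s f) = map s (ncmon f).
Proof. by rewrite -map_comp; apply: eq_map => j /=; rewrite ffunE. Qed.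

Lemma ffrenameK s t : cancel s t -> cancel (ffrename s) (ffrename t).
Proof. by move=> sK f; apply/ffunP=> j; rewrite !ffunE sK. Qed.

Lemma part_ker_ffrename s f : injective s ->
  part_ker (ffrename s f) = part_ker f.
Proof.
move=> injs; rewrite /part_ker /preim_partition; apply: eq_imset => x.
by apply/setP=> y; rewrite !inE !ffunE (inj_eq injs).
Qed.

Lemma nc_bounded_monsum (T : choiceType) (A : set T) (mon : T -> seq nat) :
  (forall t, size (mon t) = n) -> nc_bounded (monsum A mon).
Proof.
move=> szm; exists n => w nw; apply: monsum_eq0 => t _ tw.
by move: nw; rewrite -tw szm ltnn.
Qed.

Lemma monsum_ffrename (A : set {ffun 'I_n -> nat}) s t w :
  cancel s t -> cancel t s ->
  (forall u, injective u -> forall f, A f -> A (ffrename u f)) ->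
  monsum A ncmon (map s w) = monsum A ncmon w.
Proof.
move=> sK tK As; apply: (monsum_reindex (ffrenameK sK) (ffrenameK tK)).
- exact/As/(can_inj sK).
- exact/As/(can_inj tK).
by move=> f; rewrite ncmon_ffrename; split=> [->|/(inj_map (can_inj sK))].
Qed.

Fact p_series_subproof P : p_series P \in in_ncsym.
Proof.
apply/asboolP; split; last exact/nc_bounded_monsum/size_ncmon.
move=> s [t sK tK] w; apply: (monsum_ffrename _ sK tK) => u injs f /= Af j k jk.
by rewrite !ffunE (Af _ _ jk).
Qed.

Fact e_series_subproof P : e_series P \in in_ncsym.
Proof.
apply/asboolP; split; last exact/nc_bounded_monsum/size_ncmon.
move=> s [t sK tK] w; apply: (monsum_ffrename _ sK tK).
by move=> u injs f /= Af j k jk b; rewrite !ffunE => /injs; exact: Af.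
Qed.

Fact h_series_subproof P : h_series P \in in_ncsym.
Proof.
apply/asboolP; split; last by apply: nc_bounded_monsum => fL; exact: size_ncmon.
move=> s [t sK tK] w.
apply: (@monsum_reindex _ _ _ _ (fun fL => (ffrename s fL.1, fL.2))
  (fun fL => (ffrename t fL.1, fL.2))).
- by move=> [f L] /=; rewrite (ffrenameK sK).
- by move=> [f L] /=; rewrite (ffrenameK tK).
- by move=> [f L] /= Af; rewrite part_ker_ffrename //; exact: can_inj sK.
- by move=> [f L] /= Af; rewrite part_ker_ffrename //; exact: can_inj tK.
by move=> [f L] /=; rewrite ncmon_ffrename; split=> [->|/(inj_map (can_inj sK))].
Qed.

Definition p_nc P : NCSym := MkNCSym (p_series_subproof P).
Definition e_nc P : NCSym := MkNCSym (e_series_subproof P).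
Definition h_nc P : NCSym := MkNCSym (h_series_subproof P).

(* [porbits s] is the set of the (supports of the) cycles of s, fixed points
   included.  The value 0 only occurs when P is not a set partition. *)
Definition part_sign P : rat :=
  if [pick s : {perm 'I_n} | porbits s == P] is Some s then (-1) ^+ s else 0.

Lemma part_sign_porbits (s : {perm 'I_n}) : part_sign (porbits s) = (-1) ^+ s.
Proof.
rewrite /part_sign; case: pickP => [t /eqP st | /(_ s)]; last by rewrite eqxx.
by rewrite /odd_perm st.
Qed.

End SetPartitions.

Definition cone : cseries := fun m => (m == mset0)%:R.

Definition cmul (F G : cseries) : cseries := fun m =>
  \sum_(q \in [set q : {mset nat} * {mset nat} |
                 msetD q.1 q.2 = m]%classic) F q.1 * G q.2.

Definition e_cseries (k : nat) : cseries :=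
  monsum [set i : k.-tuple nat | sorted ltn i]%classic
    (fun i => seq_mset (i : seq nat)).

Definition h_cseries (k : nat) : cseries :=
  monsum [set i : k.-tuple nat | sorted leq i]%classic
    (fun i => seq_mset (i : seq nat)).

Definition cprod (u : nat -> cseries) (lam : seq nat) : cseries :=
  foldr (fun k F => cmul (u k) F) cone lam.

Definition intpart (lam : seq nat) : bool :=
  sorted geq lam && all (leq 1) lam.

Definition rho_series (F : ncseries) : cseries := fun m =>
  \sum_(w \in [set w : seq nat | seq_mset w = m]%classic) F w.

Lemma size_rename s m : size (rename s m) = size m.
Proof. by rewrite (perm_size (perm_eq_seq_mset _)) size_map. Qed.

Lemma perm_rename s (m : {mset nat}) : perm_eq (rename s m) (map s m).
Proof. exact: perm_eq_seq_mset. Qed.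

Lemma rename_seq_mset s w : rename s (seq_mset w) = seq_mset (map s w).
Proof. exact/eq_seq_msetP/perm_map/perm_eq_seq_mset. Qed.

Lemma renameK s t : cancel s t -> cancel (rename s) (rename t).
Proof.
move=> sK m; rewrite -[m in LHS]seq_mset_id !rename_seq_mset -map_comp.
by rewrite (eq_map (g := id)) ?map_id ?seq_mset_id //= => x /=; rewrite sK.
Qed.

Lemma renameD s m m' : rename s (msetD m m') = msetD (rename s m) (rename s m').
Proof.
have catD u v : msetD (seq_mset u) (seq_mset v) = seq_mset (u ++ v) :> {mset nat}.
  by apply/msetP=> x; rewrite msetE2 !mset_seqE count_cat.
rewrite -[m]seq_mset_id -[m']seq_mset_id catD !rename_seq_mset catD.
by rewrite map_cat.
Qed.

Lemma sizeD (m m' : {mset nat}) : size (msetD m m') = (size m + size m')%N.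
Proof.
rewrite -size_cat; apply: perm_size; apply/allP=> x _ /=.
by rewrite count_cat !count_mem_mset msetE2.
Qed.

Fact rho_subproof (F : NCSym) : rho_series F \in in_sym.
Proof.
case: F => F /= /asboolP[iF [d bF]]; apply/asboolP; split.
  move=> s bs m; have [t sK tK] := bs; rewrite /rho_series.
  rewrite (@reindex_fsbig _ _ _ _ _ (map s)
    [set w : seq nat | seq_mset w = m]%classic) /=.
    by apply: eq_fsbigr => w _; rewrite iF.
  split.
  - by move=> w /= <-; rewrite rename_seq_mset.
  - by move=> w w' _ _; exact/inj_map/(can_inj sK).
  - move=> w /= wm; exists (map t w) => /=; last by rewrite mapK.
    by rewrite -rename_seq_mset wm (renameK sK).
exists d => m dm; apply: fsbig1 => w /= wm; apply: bF.
by rewrite -(perm_size (perm_eq_seq_mset w)) wm.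
Qed.

Definition rho (F : NCSym) : Sym := MkSym (rho_subproof F).

Lemma cone_in_sym : cone \in in_sym.
Proof.
apply/asboolP; split.
  move=> s [t sK tK] m; rewrite /cone.
  have r0 : rename s mset0 = mset0.
    by apply/msetP=> x; rewrite /rename enum_mset0 mset_seqE mset0E.
  by rewrite -[X in _ == X]r0 (can_eq (renameK sK)).
by exists 0%N => m; rewrite /cone; case: eqP => [->|//]; rewrite enum_mset0.
Qed.

Lemma cmul_in_sym F G : F \in in_sym -> G \in in_sym -> cmul F G \in in_sym.
Proof.
move=> /asboolP[iF [d bF]] /asboolP[iG [e bG]]; apply/asboolP; split.
  move=> s bs m; have [t sK tK] := bs; rewrite /cmul.
  rewrite (@reindex_fsbig _ _ _ _ _ (fun q => (rename s q.1, rename s q.2))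
    [set q : {mset nat} * {mset nat} | msetD q.1 q.2 = m]%classic) /=.
    by apply: eq_fsbigr => q _; rewrite iF ?iG.
  split.
  - by move=> [q r] /= <-; rewrite renameD.
  - move=> [q r] [q' r'] _ _ /= [/(can_inj (renameK sK)) ->].
    by move=> /(can_inj (renameK sK)) ->.
  - move=> [q r] /= qr; exists (rename t q, rename t r) => /=.
      by rewrite -renameD qr (renameK sK).
    by rewrite !(renameK tK).
exists (d + e)%N => m dem; apply: fsbig1 => -[q r] /= qr.
have [dq|qd] := ltnP d (size (q : {mset nat})); first by rewrite bF ?mul0r.
rewrite bG ?mulr0 // ltnNge; apply: contraTN dem => re.
by rewrite -leqNgt -qr sizeD leq_add.
Qed.

Lemma monsum_inj (T : choiceType) (M : Type) (A : set T) (mon : T -> M) m t :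
  A t -> mon t = m -> (forall u, A u -> mon u = m -> u = t) ->
  monsum A mon m = 1.
Proof.
move=> At tm inj; rewrite /monsum (_ : [set _ | _]%classic = set1 t) ?fsbig_set1 //.
apply/seteqP; split=> [u /= [Au um]|u /= ->]; [exact: inj | by []].
Qed.

Lemma e_cseriesE k m : e_cseries k m = ((size m == k) && uniq m)%:R.
Proof.
case: andP => [[/eqP mk um]|nm].
  have sz : size (sort leq m) == k by rewrite size_sort mk.
  apply: (@monsum_inj _ _ _ _ _ (Tuple sz)) => /=.
  - by rewrite ltn_sorted_uniq_leq sort_uniq um sort_sorted //; exact: leq_total.
  - by rewrite -[RHS]seq_mset_id; apply/eq_seq_msetP; rewrite perm_sort.
  - move=> u /=; rewrite ltn_sorted_uniq_leq => /andP[_ su] umm; apply: val_inj => /=.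
    apply: (sorted_eq leq_trans anti_leq) => //; first exact/sort_sorted/leq_total.
    by rewrite perm_sym perm_sort -umm; exact: perm_eq_seq_mset.
apply: monsum_eq0 => t /=; rewrite ltn_sorted_uniq_leq => /andP[ut _] tm.
apply: nm; rewrite -tm (perm_size (perm_eq_seq_mset t)) size_tuple eqxx.
by rewrite (perm_uniq (perm_eq_seq_mset t)).
Qed.

Lemma h_cseriesE k (m : {mset nat}) : h_cseries k m = (size m == k)%:R.
Proof.
case: eqP => [mk|nm].
  have sz : size (sort leq m) == k by rewrite size_sort mk.
  apply: (@monsum_inj _ _ _ _ _ (Tuple sz)) => /=.
  - by rewrite sort_sorted //; exact: leq_total.
  - by rewrite -[RHS]seq_mset_id; apply/eq_seq_msetP; rewrite perm_sort.
  - move=> u /= su umm; apply: val_inj => /=.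
    apply: (sorted_eq leq_trans anti_leq) => //; first exact/sort_sorted/leq_total.
    by rewrite perm_sym perm_sort -umm; exact: perm_eq_seq_mset.
apply: monsum_eq0 => t /= _ tm; apply: nm.
by rewrite -tm (perm_size (perm_eq_seq_mset t)) size_tuple.
Qed.

Lemma e_cseries_in_sym k : e_cseries k \in in_sym.
Proof.
apply/asboolP; split.
  move=> s /bij_inj injs m; rewrite !e_cseriesE size_rename.
  by rewrite (perm_uniq (perm_rename s m)) map_inj_uniq.
by exists k => m km; rewrite e_cseriesE gtn_eqF.
Qed.

Lemma h_cseries_in_sym k : h_cseries k \in in_sym.
Proof.
apply/asboolP; split; first by move=> s _ m; rewrite !h_cseriesE size_rename.
by exists k => m km; rewrite h_cseriesE gtn_eqF.
Qed.

Lemma cprod_in_sym u lam : (forall k, u k \in in_sym) -> cprod u lam \in in_sym.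
Proof.
move=> su; elim: lam => [|k lam IH] /=; [exact: cone_in_sym | exact: cmul_in_sym].
Qed.

Definition e_sym (lam : seq nat) : Sym :=
  MkSym (cprod_in_sym lam e_cseries_in_sym).
Definition h_sym (lam : seq nat) : Sym :=
  MkSym (cprod_in_sym lam h_cseries_in_sym).

(* Main.v *)
(** Let S_P be the group of permutations preserving every block of P.  Then
    e_P = sum_(s in S_P) sgn(s) p_(cycles of s) and
    h_P = sum_(s in S_P) p_(cycles of s): at a word f both sums run over
    the permutations preserving the blocks of P /\ ker f, which cancel in pairs
    under a transposition unless these blocks are singletons, respectively
    correspond to the linear orderings of these blocks.  The terms whose cycles
    are exactly P are multiples of p_P and the others involve finer partitions,
    so induction on P gives omega(p_P) = sgn(P) p_P.  The p_P span, hence omega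
    is an involution, and so do the e_P, hence it is enough to compare rho(e_P)
    and rho(h_P).  As rho takes concatenation of words to the product, these
    factor over the blocks of P, and are the same product of factorials times
    e_lambda and h_lambda, lambda being the type of P. *)

From mathcomp Require Import finmap multiset.
From mathcomp Require Import boolp classical_sets functions cardinality fsbigop.
From mathcomp Require Import all_boot all_algebra all_fingroup.
Require Import Defs.

Set Implicit Arguments.
Unset Strict Implicit.
Unset Printing Implicit Defensive.

Import GRing.Theory Num.Theory.

Local Open Scope mset_scope.
Local Open Scope ring_scope.


(** * Set partitions and permutations *)

Section SetPartitions.
Variable n : nat.
Implicit Types (P Q : {set {set 'I_n}}) (f : {ffun 'I_n -> nat}).
Implicit Types (s t : {perm 'I_n}) (i j k : 'I_n).

Lemma same_blockE P j k : setpart P -> same_block P j k = (k \in pblock P j).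
Proof.
move=> /and3P[/eqP cP tP _].
have jP : j \in cover P by rewrite cP inE.
apply/exists_inP/idP=> [[B BP /andP[jB kB]]|kB].
  by rewrite (def_pblock tP BP jB).
by exists (pblock P j); rewrite ?pblock_mem // mem_pblock jP.
Qed.

Lemma same_block_eq P j k : setpart P ->
  same_block P j k = (pblock P j == pblock P k).
Proof.
move=> sP; rewrite same_blockE //; move: sP => /and3P[/eqP cP tP _].
by rewrite eq_pblock // cP inE.
Qed.

Lemma same_block_refl P j : setpart P -> same_block P j j.
Proof. by move=> sP; rewrite same_block_eq. Qed.

Lemma same_block_sym P j k : same_block P j k = same_block P k j.
Proof. by apply: eq_existsb => B; rewrite [(j \in B) && _]andbC. Qed.

Lemma same_block_trans P : setpart P -> transitive (same_block P).
Proof. by move=> sP j i k; rewrite !same_block_eq // => /eqP->. Qed.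

Lemma mem_setpart P B j : setpart P -> B \in P -> j \in B ->
  B = [set k | same_block P j k]%SET.
Proof.
move=> sP BP jB; apply/setP=> k; rewrite inE same_blockE //.
by move: sP => /and3P[_ tP _]; rewrite (def_pblock tP BP jB).
Qed.

Lemma setpart_inj P Q : setpart P -> setpart Q ->
  same_block P =2 same_block Q -> P = Q.
Proof.
suff sub (A B : {set {set 'I_n}}) : setpart A -> setpart B ->
    same_block A =2 same_block B -> A \subset B.
  by move=> sP sQ PQ; apply/eqP; rewrite eqEsubset !sub.
move=> sA sB AB; apply/subsetP=> C CA.
have /and3P[_ _ A0] := sA.
have /set0Pn[j jC] : C != set0 by apply: contraNneq A0 => <-.
rewrite (mem_setpart sA CA jC).
rewrite (_ : [set k | _]%SET = pblock B j).
  by apply: pblock_mem; have /and3P[/eqP-> _ _] := sB; rewrite inE.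
by apply/setP=> k; rewrite inE AB same_blockE.
Qed.

Lemma setpart_ker f : setpart (part_ker f).
Proof. exact: preim_partitionP. Qed.

Lemma same_block_ker f j k : same_block (part_ker f) j k = (f j == f k).
Proof.
rewrite same_blockE ?setpart_ker // /part_ker.
rewrite pblock_equivalence_partition ?inE //.
by move=> x y z _ _ _ /=; split=> [|/eqP->].
Qed.

Lemma same_block_meet f P j k : setpart P ->
  same_block (part_meet (part_ker f) P) j k = same_block P j k && (f j == f k).
Proof.
move=> sP; have [_ Mf MP _] := part_meetP (setpart_ker f) sP.
rewrite -same_block_ker; apply/idP/andP.
  case/exists_inP=> B BM /andP[jB kB]; split; apply/exists_inP.
    have /exists_inP[C CP /subsetP BC] := forall_inP MP _ BM.
    by exists C => //; rewrite !BC.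
  have /exists_inP[C CP /subsetP BC] := forall_inP Mf _ BM.
  by exists C => //; rewrite !BC.
case=> /exists_inP[C CP /andP[jC kC]] /exists_inP[B Bf /andP[jB kB]].
apply/exists_inP; exists (B :&: C)%SET; last by rewrite !inE jB jC kB.
by rewrite !inE imset2_f // andbT; apply/set0Pn; exists j; rewrite inE jB.
Qed.

Lemma setpart_meet f P : setpart P -> setpart (part_meet (part_ker f) P).
Proof. by case/(part_meetP (setpart_ker f)). Qed.

Lemma setpart_porbits s : setpart (porbits s).
Proof.
apply/and3P; split.
- apply/eqP/setP=> j; rewrite inE; apply/bigcupP.
  by exists (porbit s j); rewrite ?imset_f ?porbit_id.
- apply/trivIsetP=> _ _ /imsetP[i _ ->] /imsetP[j _ ->] neq.
  rewrite -setI_eq0; apply/eqP/setP=> k; rewrite !inE; apply/negP=> /andP[].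
  by rewrite -!eq_porbit_mem => /eqP ki /eqP kj; rewrite -ki -kj eqxx in neq.
- apply/negP=> /imsetP[j _ j0].
  by have := porbit_id s j; rewrite -j0 inE.
Qed.

Lemma same_block_porbits s j k : same_block (porbits s) j k = (k \in porbit s j).
Proof.
apply/exists_inP/idP=> [[_ /imsetP[i _ ->] /andP[]]|kj].
  by rewrite -!eq_porbit_mem => /eqP-> /eqP->.
by exists (porbit s j); rewrite ?imset_f ?porbit_id.
Qed.

Lemma same_block_porbits_const (T : Type) (f : 'I_n -> T) s :
  (forall j k, same_block (porbits s) j k -> f j = f k) <->
  forall j, f (s j) = f j.
Proof.
split=> [fs j|fs j k].
  by apply/esym/fs; rewrite same_block_porbits (mem_porbit s 1).
rewrite same_block_porbits => /porbitP[m ->]; elim: m => [|m IH].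
  by rewrite expg0 perm1.
by rewrite expgSr permM fs.
Qed.

(** The witness moves each point to the next one in the enumeration of its block. *)
Lemma porbits_ex P : setpart P -> exists s, porbits s = P.
Proof.
move=> sP; have /and3P[/eqP cP tP P0] := sP.
pose g j := next (enum (pblock P j)) j.
have jj j : j \in enum (pblock P j).
  by rewrite mem_enum mem_pblock cP inE.
have gB j : pblock P (g j) = pblock P j.
  apply/eqP; rewrite eq_sym -same_block_eq // same_blockE //.
  by rewrite -mem_enum mem_next.
have ginj : injective g.
  move=> j k gjk; have jk : pblock P j = pblock P k by rewrite -gB gjk gB.
  rewrite -(prev_next (enum_uniq (pblock P j)) j) [next _ j]gjk jk /g.
  by rewrite prev_next ?enum_uniq.
exists (perm ginj); apply: setpart_inj => // [|j k]; first exact: setpart_porbits.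
rewrite same_block_porbits same_blockE // -[in RHS]mem_enum.
apply/idP/idP.
  move=> /porbitP[m ->]; rewrite mem_enum -same_blockE //.
  elim: m => [|m IH]; first by rewrite expg0 perm1 same_block_refl.
  by move: IH; rewrite expgSr permM permE !same_block_eq // gB.
(* Iterating [next] reaches every point of the block, which gives the power of the witness taking
   [j] to [k]. *)
have cyc : fcycle (next (enum (pblock P j))) (enum (pblock P j)).
  by rewrite cycle_next ?enum_uniq.
rewrite -(fconnect_cycle cyc (jj j)) => /iter_findex <-.
apply/porbitP; exists (findex (next (enum (pblock P j))) j k).
elim: (findex _ _ _) => [|m IH]; first by rewrite expg0 perm1.
rewrite expgSr permM -IH iterS permE /g.
suff /eqP-> : pblock P (iter m (next (enum (pblock P j))) j) == pblock P j by [].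
rewrite eq_sym -same_block_eq // same_blockE // -mem_enum.
by elim: (m) => [|q IHq] //=; rewrite mem_next.
Qed.

(** For a set partition, membership in its Young subgroup S_P. *)
Definition block_perm P s : bool := [forall j, same_block P j (s j)].

Lemma block_perm_porbits P s j k : setpart P -> block_perm P s ->
  same_block (porbits s) j k -> same_block P j k.
Proof.
move=> sP /forallP Ps; rewrite same_block_porbits => /porbitP[m ->].
elim: m => [|m IH]; first by rewrite expg0 perm1 same_block_refl.
by rewrite expgSr permM (same_block_trans sP IH).
Qed.

Lemma block_perm_id P s : setpart P -> porbits s = P -> block_perm P s.
Proof.
move=> sP <-; apply/forallP=> j.
by rewrite same_block_porbits (mem_porbit s 1).
Qed.

(** Induction on the number of pairs sharing a block: the cycles of a permutation in S_P refine P,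
    so there are strictly fewer such pairs unless the cycles are P itself. *)
Lemma setpart_triangular (X : {set {set 'I_n}} -> Prop) :
  (forall P, setpart P ->
     (forall s, block_perm P s -> porbits s != P -> X (porbits s)) -> X P) ->
  forall P, setpart P -> X P.
Proof.
move=> step P sP.
pose pairs Q := [set jk : 'I_n * 'I_n | same_block Q jk.1 jk.2]%SET.
have [m] := ubnP #|pairs P|; elim: m => // m IH in P sP *.
rewrite ltnS => Pm; apply: step => // s Ps neq.
apply: IH; first exact: setpart_porbits.
apply: leq_trans Pm; apply: proper_card; rewrite properEneq.
apply/andP; split; last first.
  by apply/subsetP=> -[j k]; rewrite !inE /=; exact: block_perm_porbits.
apply: contra_neq neq => /setP E.
apply: setpart_inj => //; first exact: setpart_porbits.
by move=> j k; have := E (j, k); rewrite !inE.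
Qed.

End SetPartitions.

(** * The coefficients of the three families *)

Section Evaluation.
Variable n : nat.
Implicit Types (P Q : {set {set 'I_n}}) (f g : {ffun 'I_n -> nat}).
Implicit Types (s t : {perm 'I_n}) (i j k : 'I_n).

Lemma ncmon_inj : injective (@ncmon n).
Proof.
move=> f g /eq_in_map fg; apply/ffunP=> j; apply: fg; exact: mem_enum.
Qed.

Lemma ncmon_nth (w : seq nat) : size w = n ->
  ncmon [ffun j : 'I_n => nth 0%N w j] = w.
Proof.
move=> sw; rewrite /ncmon; under eq_map do rewrite ffunE.
by rewrite (map_comp (nth 0%N w)) val_enum_ord map_nth_iota0 ?take_oversize ?sw.
Qed.

Lemma monsum_ncmon (A : set {ffun 'I_n -> nat}) f :
  monsum A (@ncmon n) (ncmon f) = `[< A f >]%:R.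
Proof.
case: asboolP => Af; first by apply: (monsum_inj Af) => // g _ /ncmon_inj.
by apply: monsum_eq0 => g Ag /ncmon_inj gf; rewrite gf in Ag.
Qed.

Lemma monsum_size (A : set {ffun 'I_n -> nat}) w :
  size w != n -> monsum A (@ncmon n) w = 0.
Proof.
by move=> wn; apply: monsum_eq0 => f _ fw; rewrite -fw size_ncmon eqxx in wn.
Qed.

Lemma h_series_size P w : size w != n -> h_series P w = 0.
Proof.
by move=> wn; apply: monsum_eq0 => f _ fw; rewrite -fw size_ncmon eqxx in wn.
Qed.

Lemma p_seriesE P f : p_series P (ncmon f) =
  [forall j, forall k, same_block P j k ==> (f j == f k)]%:R.
Proof.
rewrite /p_series monsum_ncmon; congr (nat_of_bool _)%:R.
apply/asboolP/'forall_forallP=> [H j k|H j k jk].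
  by apply/implyP=> /H ->.
by apply/eqP; move: jk; exact/implyP/H.
Qed.

Lemma p_series_porbits s f :
  p_series (porbits s) (ncmon f) = [forall j, f (s j) == f j]%:R.
Proof.
rewrite /p_series monsum_ncmon; congr (nat_of_bool _)%:R.
apply/asboolP/forallP => [/same_block_porbits_const H j|H]; first exact/eqP.
by apply/same_block_porbits_const => j; apply/eqP.
Qed.

Lemma e_seriesE P f : setpart P -> e_series P (ncmon f) =
  [forall j, forall k, same_block (part_meet (part_ker f) P) j k ==> (j == k)]%:R.
Proof.
move=> sP; rewrite /e_series monsum_ncmon; congr (nat_of_bool _)%:R.
apply/asboolP/'forall_forallP => [H j k|H j k jk Pjk fjk].
  rewrite same_block_meet //; apply/implyP=> /andP[Pjk /eqP fjk].
  by apply: contraT => /H /(_ Pjk).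
have /implyP := H j k.
by rewrite same_block_meet // Pjk fjk eqxx (negPf jk) => /(_ isT).
Qed.

Definition perm_ordering Q s : {ffun {set 'I_n} -> seq 'I_n} :=
  [ffun C => if C \in Q then map s (enum C) else [::]].

(** An ordering of a block is a rearrangement of its enumeration; the inverse map sends the i-th
    point of the enumeration to the i-th point of the ordering. *)
Lemma perm_ordering_bij Q : setpart Q ->
  set_bij [set s | block_perm Q s]%classic (block_orderings Q) (perm_ordering Q).
Proof.
move=> sQ; have /and3P[/eqP cQ tQ Q0] := sQ.
have pQ j : pblock Q j \in Q by rewrite pblock_mem // cQ inE.
have pj j : j \in pblock Q j by rewrite mem_pblock cQ inE.
split.
- move=> s /= /forallP Qs C; rewrite ffunE; case: ifP => CQ; rewrite CQ //.
  apply: uniq_perm; rewrite ?enum_uniq ?(map_inj_uniq perm_inj) ?enum_uniq //.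
  have us : uniq (map s (enum C)) by rewrite (map_inj_uniq perm_inj) enum_uniq.
  have sub : {subset map s (enum C) <= enum C}.
    move=> _ /mapP[j jC ->]; move: jC; rewrite !mem_enum => jC.
    by rewrite (mem_setpart sQ CQ jC) inE.
  by have [|_ E] := uniq_min_size us sub; rewrite ?size_map.
- move=> s t _ _ /= /ffunP st; apply/permP=> j.
  have := st (pblock Q j); rewrite !ffunE pQ => /eq_in_map; apply.
  by rewrite mem_enum.
- move=> L /= oL.
  have LQ C : C \in Q -> perm_eq (L C) (enum C) by move=> CQ; have := oL C; rewrite CQ.
  pose B j := pblock Q j.
  have szL j : size (L (B j)) = size (enum (B j)) by rewrite (perm_size (LQ _ (pQ j))).
  have uL j : uniq (L (B j)) by rewrite (perm_uniq (LQ _ (pQ j))) enum_uniq.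
  pose u j := nth j (L (B j)) (index j (enum (B j))).
  have iB j : (index j (enum (B j)) < size (L (B j)))%N.
    by rewrite szL index_mem mem_enum /B.
  have uB j : B (u j) = B j.
    apply/eqP; rewrite eq_sym /B -same_block_eq // same_blockE // -mem_enum.
    by rewrite -(perm_mem (LQ _ (pQ j))) mem_nth.
  have uinj : injective u.
    move=> j k ujk; have Bjk : B j = B k by rewrite -uB ujk uB.
    have ik : (index k (enum (B j)) < size (L (B j)))%N by rewrite Bjk.
    move/eqP: ujk; rewrite /u -Bjk (set_nth_default j k ik) nth_uniq //.
    move=> /eqP/(congr1 (nth j (enum (B j)))).
    by rewrite !nth_index ?mem_enum // Bjk.
  exists (perm uinj) => /=.
    apply/forallP=> j; rewrite permE same_block_eq //; apply/eqP/esym/uB.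
  apply/ffunP=> C; rewrite ffunE; case: ifP => [CQ|nCQ]; last first.
    by have := oL C; rewrite nCQ => /eqP.
  have sz : size (map (perm uinj) (enum C)) = size (L C).
    by rewrite size_map (perm_size (LQ _ CQ)).
  (* A nonempty enumeration supplies the default element for [nth]. *)
  case E: (enum C) => [|x0 r].
    by move: sz; rewrite E /= => /esym/size0nil.
  rewrite -E; apply: (@eq_from_nth _ x0) => // i.
  rewrite size_map => iC; rewrite (nth_map x0) // permE /u.
  have xC : nth x0 (enum C) i \in C by rewrite -mem_enum mem_nth.
  rewrite /B (def_pblock tQ CQ xC) index_uniq ?enum_uniq //.
  by apply: set_nth_default; rewrite -sz size_map.
Qed.

(** The word determines the function by [ncmon_inj], so only the orderings vary, and
    [perm_ordering_bij] counts them. *)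
Lemma h_seriesE P f : setpart P -> h_series P (ncmon f) =
  #|[pred s | block_perm (part_meet (part_ker f) P) s]|%:R.
Proof.
move=> sP; set Q := part_meet _ _.
have sQ : setpart Q by exact: setpart_meet.
rewrite /h_series /monsum.
have [sub inj surj] := perm_ordering_bij sQ.
rewrite (@reindex_fsbig _ _ _ _ _ (fun s : {perm 'I_n} => (f, perm_ordering Q s))
   [set s | block_perm Q s]%classic).
  rewrite (@fsbigE _ _ _ _ _ (enum [pred s | block_perm Q s])) ?enum_uniq //=.
  - rewrite big_enum_cond /= -sum1_card natr_sum; apply: eq_bigl => s.
    by rewrite !inE; case: (boolP (block_perm Q s)) => //= Qs; apply/mem_set.
  - by move=> s; rewrite /= mem_enum.
  - by move=> s /= Qs; rewrite mem_enum inE Qs.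
split.
- by move=> s /= Qs; split=> //=; exact: sub.
- by move=> s t Qs Qt [] /inj -> //; rewrite inE.
- move=> [g L] /= [oL /ncmon_inj gf]; rewrite gf in oL *.
  by have [s Qs <-] := surj L oL; exists s.
Qed.

(** The second factor is the coefficient of [p_series (porbits s)] at [ncmon f], so a sum over S_P
    of these coefficients becomes a sum over the Young subgroup of the meet. *)
Lemma block_perm_meet P f s : setpart P ->
  block_perm (part_meet (part_ker f) P) s =
  block_perm P s && [forall j, f (s j) == f j].
Proof.
move=> sP; apply/forallP/andP.
  move=> H; split; apply/forallP=> j; have := H j; rewrite same_block_meet //.
    by case/andP.
  by case/andP=> _; rewrite eq_sym.
by case=> /forallP H1 /forallP H2 j; rewrite same_block_meet // H1 eq_sym H2.
Qed.

(* If two distinct points share a block, multiplication by their transposition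
   is a sign reversing involution. *)
Lemma sum_sign_block_perm Q : setpart Q ->
  \sum_(s : {perm 'I_n} | block_perm Q s) ((-1) ^+ s : rat) =
  [forall j, forall k, same_block Q j k ==> (j == k)]%:R.
Proof.
move=> sQ; case: (boolP [forall j, _]) => [/'forall_forallP H|].
  rewrite (big_pred1 (1%g : {perm 'I_n})) ?odd_perm1 //= => s.
  apply/forallP/eqP => [Qs|-> j].
    by apply/permP=> j; rewrite perm1; apply/esym/eqP/(implyP (H j (s j)))/Qs.
  by rewrite perm1 same_block_refl.
rewrite negb_forall => /existsP[j]; rewrite negb_forall => /existsP[k].
rewrite negb_imply => /andP[Qjk jk].
have tQ s : block_perm Q (s * tperm j k)%g = block_perm Q s.
  have tb i : same_block Q i (tperm j k i).
    by case: tpermP => [->|->|_ _] //; rewrite ?same_block_refl // same_block_sym.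
  apply: eq_forallb => i; rewrite permM.
  apply/idP/idP=> [Qi|/same_block_trans-> //].
  by apply: same_block_trans Qi _ => //; rewrite same_block_sym.
rewrite -[RHS]/(0 : rat); set S := \sum_(_ | _) _; suff : S = - S.
  by move/eqP; rewrite -addr_eq0 -mulr2n -mulr_natl mulf_eq0 pnatr_eq0 => /eqP.
rewrite {1}/S (reindex_inj (mulIg (tperm j k))) /= -sumrN.
apply: eq_big => [s|s _]; first exact: tQ.
by rewrite odd_permM odd_tperm jk addbT signrN.
Qed.

End Evaluation.

(** * Power sums: eigenvalues and spanning *)

Lemma ncsym_ext (F G : NCSym) : (forall w, ncsym_val F w = ncsym_val G w) ->
  F = G.
Proof. by move=> FG; apply/val_inj/funext. Qed.

Lemma ncsym_lin (a : rat) (F G : NCSym) w :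
  ncsym_val (a *: F + G) w = a * ncsym_val F w + ncsym_val G w.
Proof. by []. Qed.

Lemma ncsym_sum (I : Type) (r : seq I) (p : pred I) (a : I -> rat)
    (F : I -> NCSym) w :
  ncsym_val (\sum_(i <- r | p i) a i *: F i) w =
    \sum_(i <- r | p i) a i * ncsym_val (F i) w.
Proof.
elim: r => [|i r IH]; first by rewrite !big_nil.
by rewrite !big_cons; case: (p i); rewrite // ncsym_lin IH.
Qed.

Section PowerSums.
Variable n : nat.
Implicit Types (P Q : {set {set 'I_n}}) (f g : {ffun 'I_n -> nat}).
Implicit Types (s t : {perm 'I_n}) (i j k : 'I_n).

Lemma e_nc_perm_sum P : setpart P ->
  e_nc P = \sum_(s : {perm 'I_n} | block_perm P s) (-1) ^+ s *: p_nc (porbits s).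
Proof.
move=> sP; apply: ncsym_ext => w; rewrite ncsym_sum /=.
have [wn|wn] := eqVneq (size w) n; last first.
  rewrite /e_series monsum_size // big1 // => s _.
  by rewrite /p_series monsum_size // mulr0.
rewrite -(ncmon_nth wn); set f := finfun _.
rewrite e_seriesE // -sum_sign_block_perm ?setpart_meet // [RHS]big_mkcond.
rewrite [LHS]big_mkcond; apply: eq_bigr => s _; rewrite block_perm_meet //.
rewrite p_series_porbits; case: (block_perm P s) => //=.
by case: [forall j, _]; rewrite ?mulr1 ?mulr0.
Qed.

Lemma h_nc_perm_sum P : setpart P ->
  h_nc P = \sum_(s : {perm 'I_n} | block_perm P s) p_nc (porbits s).
Proof.
move=> sP; under eq_bigr do rewrite -[p_nc _]scale1r.
apply: ncsym_ext => w; rewrite ncsym_sum /=.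
have [wn|wn] := eqVneq (size w) n; last first.
  rewrite h_series_size // big1 // => s _.
  by rewrite /p_series ?monsum_size // mulr0.
rewrite -(ncmon_nth wn); set f := finfun _.
rewrite h_seriesE // -sum1_card natr_sum [RHS]big_mkcond [LHS]big_mkcond.
apply: eq_bigr => s _; rewrite inE block_perm_meet //.
rewrite p_series_porbits; case: (block_perm P s) => //=.
by case: [forall j, _]; rewrite ?mulr1.
Qed.

(** For a set partition, the product of (#|B| - 1)! over its blocks B. *)
Definition cycle_count P : nat := #|[pred s : {perm 'I_n} | porbits s == P]|.

Lemma cycle_count_neq0 P : setpart P -> (cycle_count P)%:R != 0 :> rat.
Proof.
move=> sP; rewrite pnatr_eq0 -lt0n; have [s sE] := porbits_ex sP.
by apply/card_gt0P; exists s; rewrite inE sE eqxx.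
Qed.

Lemma part_sign_sqr P : setpart P -> part_sign P * part_sign P = 1.
Proof.
by move=> sP; have [s <-] := porbits_ex sP; rewrite part_sign_porbits -expr2 sqrr_sign.
Qed.

(** The permutations whose cycles are exactly P lie in S_P and share the coefficient [c], so they
    gather into one diagonal term; [c] is the sign of P for e and 1 for h. *)
Lemma perm_sum_split (V : lmodType rat) (F : {set {set 'I_n}} -> V)
    (a : {perm 'I_n} -> rat) (c : rat) P :
  setpart P -> (forall s, porbits s = P -> a s = c) ->
  \sum_(s : {perm 'I_n} | block_perm P s) a s *: F (porbits s) =
  (c * (cycle_count P)%:R) *: F P +
  \sum_(s : {perm 'I_n} | block_perm P s && (porbits s != P)) a s *: F (porbits s).
Proof.
move=> sP aP; rewrite (bigID (fun s => porbits s == P)) /=; congr (_ + _).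
rewrite (eq_bigl [pred s | porbits s == P]) => [|s]; last first.
  by rewrite inE andb_idl // => /eqP; exact: block_perm_id.
rewrite (eq_bigr (fun=> c *: F P)) => [|s /eqP sE]; last by rewrite aP // sE.
by rewrite sumr_const -scaler_nat scalerA mulrC.
Qed.

Lemma e_nc_split P : setpart P ->
  e_nc P = (part_sign P * (cycle_count P)%:R) *: p_nc P +
    \sum_(s : {perm 'I_n} | block_perm P s && (porbits s != P))
      (-1) ^+ s *: p_nc (porbits s).
Proof.
move=> sP; rewrite e_nc_perm_sum //; apply: perm_sum_split => // s <-.
by rewrite part_sign_porbits.
Qed.

(** A constant word satisfies every equality required by p_P, so its coefficient is 1. *)
Lemma p_nc_neq0 P : p_nc P != 0.
Proof.
apply/eqP=> /(congr1 (fun F : NCSym => ncsym_val F (ncmon [ffun _ : 'I_n => 0%N]))) /=.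
rewrite p_seriesE (_ : [forall j, _]) => [/eqP|]; first by rewrite oner_eq0.
by apply/'forall_forallP=> j k; rewrite !ffunE eqxx implybT.
Qed.

Lemma omega_p_nc (omega : {linear NCSym -> NCSym}) :
  (forall P, setpart P -> omega (e_nc P) = h_nc P) ->
  forall P, setpart P -> omega (p_nc P) = part_sign P *: p_nc P.
Proof.
move=> omega_e; apply: setpart_triangular => P sP IH.
have := omega_e P sP; rewrite e_nc_split // h_nc_perm_sum //.
under [RHS]eq_bigr do rewrite -[p_nc _]scale1r.
rewrite (perm_sum_split (@p_nc n) (c := 1)) // linearD linearZ linear_sum /=.
(* By induction [omega] multiplies each finer power sum by the sign of [s], which cancels the sign
   already there. *)
rewrite (eq_bigr (fun s => 1 *: p_nc (porbits s))) => [|s /andP[Ps neq]]; last first.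
  rewrite linearZ /= IH // part_sign_porbits scalerA -expr2 sqrr_sign //.
(* The lower terms and then the cycle count cancel, leaving sgn(P) omega(p_P) = p_P, and the square
   of the sign is 1. *)
move=> /addIr; rewrite mul1r mulrC -scalerA => /scalerI E.
rewrite -[LHS]scale1r -(part_sign_sqr sP) -scalerA E //.
exact: cycle_count_neq0.
Qed.

End PowerSums.

(** * Predicates closed under linear combinations *)

Section Span.
Variable K : NCSym -> Prop.
Hypothesis K0 : K 0.
Hypothesis Klin : forall a F G, K F -> K G -> K (a *: F + G).

Lemma span_sum (I : Type) (r : seq I) (p : pred I) (a : I -> rat)
    (F : I -> NCSym) :
  (forall i, p i -> K (F i)) -> K (\sum_(i <- r | p i) a i *: F i).
Proof.
move=> KF; elim: r => [|i r IH]; first by rewrite big_nil.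
by rewrite big_cons; case: ifP => // /KF Ki; exact: Klin.
Qed.

(** The expansion of e_P in power sums is triangular with nonzero diagonal coefficient [c], so it
    can be solved for p_P. *)
Lemma span_e_p (n : nat) :
  (forall P : {set {set 'I_n}}, setpart P -> K (e_nc P)) ->
  forall P : {set {set 'I_n}}, setpart P -> K (p_nc P).
Proof.
move=> Ke; apply: setpart_triangular => P sP IH.
set c := part_sign P * (cycle_count P)%:R.
have c0 : c != 0.
  rewrite mulf_neq0 ?cycle_count_neq0 //; apply: contra_eq_neq (part_sign_sqr sP).
  by move=> ->; rewrite mul0r eq_sym oner_eq0.
have -> : p_nc P = c^-1 *: (e_nc P - \sum_(s : {perm 'I_n} |
    block_perm P s && (porbits s != P)) (-1) ^+ s *: p_nc (porbits s)).
  by rewrite e_nc_split // addrK scalerA mulVf // scale1r.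
rewrite -[_ *: _]addr0; apply: Klin => //.
rewrite addrC -scaleN1r; apply: Klin; last exact: Ke.
by apply: span_sum => s /andP[]; exact: IH.
Qed.

End Span.

(** * Dependence of coefficients on kernels, and spanning by power sums *)

Definition swap (a b z : nat) : nat :=
  if z == a then b else if z == b then a else z.

Lemma swapK a b : involutive (swap a b).
Proof.
move=> z; rewrite /swap; have [->|za] := eqVneq z a.
  by have [//|_] := eqVneq b a; rewrite eqxx.
have [->|zb] := eqVneq z b; first by rewrite eqxx.
by rewrite (negPf za) (negPf zb).
Qed.

Lemma swapL a b : swap a b a = b. Proof. by rewrite /swap eqxx. Qed.

(** Induction on the list. If the value [f j] has occurred before, [s] already works; otherwise [s]
    is followed by the transposition of [s (f j)] and [g j], which moves no earlier value because f
    and g identify the same points. *)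
Lemma extend_bijection (T : eqType) (f g : T -> nat) (l : seq T) :
  (forall j k, (f j == f k) = (g j == g k)) ->
  exists2 s : nat -> nat, bijective s & {in l, forall j, s (f j) = g j}.
Proof.
move=> fg; elim: l => [|j l [s bs sl]]; first by exists id => //; exists id.
have [[k kl fjk]|nj] := altP (@hasP _ (fun k => f k == f j) l).
  exists s => // i; rewrite inE => /orP[/eqP->|/sl//].
  by rewrite -(eqP fjk) sl //; apply/eqP; rewrite -fg.
exists (swap (s (f j)) (g j) \o s).
  by apply: bij_comp => //; exists (swap (s (f j)) (g j)); exact: swapK.
move=> i; rewrite inE => /orP[/eqP->|il] /=; first by rewrite swapL.
have fij : f i != f j.
  by apply: contraNneq nj => fij; apply/hasP; exists i; rewrite ?fij.
by rewrite /swap (inj_eq (bij_inj bs)) (negPf fij) sl // -fg (negPf fij).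
Qed.

Section PowerSumsSpan.
Variable K : NCSym -> Prop.
Hypothesis K0 : K 0.
Hypothesis Klin : forall a F G, K F -> K G -> K (a *: F + G).
Hypothesis Kp : forall n (P : {set {set 'I_n}}), setpart P -> K (p_nc P).

Lemma ncsym_kernel (n : nat) (F : NCSym) (f g : {ffun 'I_n -> nat}) :
  (forall j k, (f j == f k) = (g j == g k)) ->
  ncsym_val F (ncmon f) = ncsym_val F (ncmon g).
Proof.
move=> fg; have [s bs sfg] := extend_bijection (enum 'I_n) fg.
case: F => F /= /asboolP[/(_ s bs (ncmon f)) <- _]; congr F.
by rewrite -map_comp; apply/eq_in_map => j /sfg.
Qed.

(** Gives a representative word with kernel P, at which the coefficient of an invariant series can
    be read. *)
Definition block_label n (P : {set {set 'I_n}}) : {ffun 'I_n -> nat} :=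
  [ffun j => enum_rank (pblock P j) : nat].

Lemma block_label_eq n (P : {set {set 'I_n}}) j k : setpart P ->
  (block_label P j == block_label P k) = same_block P j k.
Proof.
move=> sP; rewrite same_block_eq // !ffunE.
by rewrite (inj_eq val_inj) (inj_eq enum_rank_inj).
Qed.

(** With equivalence relations kept as sets of pairs, refinement becomes inclusion and the
    cardinality is a rank for elimination. *)
Definition kernel_pairs n (f : {ffun 'I_n -> nat}) : {set 'I_n * 'I_n} :=
  [set jk | f jk.1 == f jk.2]%SET.

Definition block_pairs n (P : {set {set 'I_n}}) : {set 'I_n * 'I_n} :=
  [set jk | same_block P jk.1 jk.2]%SET.

Lemma p_series_pairs n (P : {set {set 'I_n}}) f :
  p_series P (ncmon f) = (block_pairs P \subset kernel_pairs f)%:R.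
Proof.
rewrite p_seriesE; congr (nat_of_bool _)%:R.
apply/'forall_forallP/subsetP => [H [j k]|H j k].
  by rewrite !inE /=; exact/implyP.
by apply/implyP; have := H (j, k); rewrite !inE.
Qed.

Lemma block_pairs_inj n (P Q : {set {set 'I_n}}) :
  setpart P -> setpart Q -> block_pairs P = block_pairs Q -> P = Q.
Proof.
move=> sP sQ /setP E; apply: setpart_inj => // j k.
by have := E (j, k); rewrite !inE.
Qed.

Lemma block_pairs_ker n (f : {ffun 'I_n -> nat}) :
  block_pairs (part_ker f) = kernel_pairs f.
Proof. by apply/setP=> -[j k]; rewrite !inE same_block_ker. Qed.

(* Subtracting multiples of the p_P with a given number of pairs kills the
   values of F on words whose kernel has that many pairs, because p_P only sees
   kernels coarser than P. *)
Lemma span_p_degree (n : nat) (F : NCSym) :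
  (forall G : NCSym, (forall w, (n <= size w)%N -> ncsym_val G w = 0) -> K G) ->
  (forall w, (n < size w)%N -> ncsym_val F w = 0) -> K F.
Proof.
(* [N] exceeds the number of pairs of any kernel. At stage [m] the kernels with fewer than N - m
   pairs have been cleared: none when m = N, all when m = 0. *)
move=> IHn; pose N := (n * n).+1.
suff H m (G : NCSym) : (forall w, (n < size w)%N -> ncsym_val G w = 0) ->
    (forall f : {ffun 'I_n -> nat}, (#|kernel_pairs f| + m < N)%N ->
       ncsym_val G (ncmon f) = 0) -> K G.
  by move=> Fn; apply: (H N) => // f; rewrite ltnNge leq_addl.
elim: m G => [|m IH] G Gn Gm.
  apply: IHn => w; rewrite leq_eqVlt => /orP[/eqP wn|/Gn//].
  rewrite -(ncmon_nth (esym wn)) Gm // addn0 ltnS.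
  by rewrite (leq_trans (max_card _)) // card_prod card_ord.
pose p (P : {set {set 'I_n}}) := setpart P && (#|block_pairs P| + m.+1 == N)%N.
(* The scalar [a] lets the same sum be subtracted with a = -1 and added back with a = 1. *)
pose S a := \sum_(P | p P) (a * ncsym_val G (ncmon (block_label P))) *: p_nc P.
have KS a : K (S a) by apply: span_sum => // P /andP[sP _]; exact: Kp.
have SE a w : ncsym_val (S a) w =
    \sum_(P | p P) (a * ncsym_val G (ncmon (block_label P))) * p_series P w.
  by rewrite ncsym_sum.
have S1 : S 1 = - S (-1).
  rewrite /S -sumrN; apply: eq_bigr => P _.
  by rewrite mulN1r mul1r scaleNr opprK.
suff KG : K (1 *: G + S (-1)).
  have -> : G = 1 *: (1 *: G + S (-1)) + S 1 by rewrite S1 !scale1r addrK.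
  exact: Klin.
apply: IH => [w nw|f fm]; rewrite ncsym_lin mul1r SE.
  rewrite Gn // add0r big1 // => P _.
  by rewrite /p_series monsum_size ?mulr0 // gtn_eqF.
have sf := setpart_ker f.
have [fN|fN] := eqVneq (#|kernel_pairs f| + m.+1)%N N; last first.
  (* This kernel has fewer pairs than every P in the sum, so it contains none of them. *)
  have fN' : (#|kernel_pairs f| + m.+1 < N)%N by rewrite ltn_neqAle fN addnS.
  rewrite Gm // add0r big1 // => P /andP[_ /eqP PN].
  rewrite p_series_pairs; case: (boolP (_ \subset _)) => [/subset_leq_card|_].
    by rewrite -(leq_add2r m.+1) PN leqNgt fN'.
  by rewrite mulr0.
(* At equal cardinality, inclusion forces P to be the kernel of [f]; its term cancels the value of
   [G], the representative having the same kernel as [f]. *)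
rewrite (bigD1 (part_ker f)) /= ?/p ?sf ?block_pairs_ker ?fN ?eqxx //.
rewrite p_series_pairs block_pairs_ker subxx mulr1 mulN1r.
rewrite (@ncsym_kernel _ _ _ f) => [|j k]; last first.
  by rewrite block_label_eq // same_block_ker.
rewrite addrA subrr add0r big1 // => P /andP[/andP[sP /eqP PN] neq].
rewrite p_series_pairs; case: (boolP (_ \subset _)) => [PF|_]; last by rewrite mulr0.
case/negP: neq; apply/eqP/block_pairs_inj => //; rewrite block_pairs_ker.
by apply/eqP; rewrite eqEcard PF -(leq_add2r m.+1) fN PN leqnn.
Qed.

(** Bounded degree gives an initial length bound, which [span_p_degree] lowers one by one until the
    series is 0. *)
Lemma span_p (F : NCSym) : K F.
Proof.
suff H n (G : NCSym) : (forall w, (n <= size w)%N -> ncsym_val G w = 0) -> K G.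
  by have /asboolP[_ [d Fd]] := valP F; exact: H d.+1 F Fd.
elim: n G => [|n IHn] G Gn; last exact: span_p_degree Gn.
by have -> : G = 0 by apply: ncsym_ext => w; rewrite Gn.
Qed.

End PowerSumsSpan.

(** * Counting permutations that preserve a relation *)

Section RelationPermutations.
Variables (T : finType) (r : rel T).

(** For an equivalence relation, the product of the factorials of the class sizes in [l]: a class of
    size c contributes c, c - 1, ..., 1. *)
Fixpoint rel_fact (l : seq T) : nat :=
  if l is x :: l' then (count (r x) l * rel_fact l')%N else 1%N.

Lemma rel_fact_cat (l1 l2 : seq T) :
  (forall x y, x \in l1 -> y \in l2 -> ~~ r x y) ->
  rel_fact (l1 ++ l2) = (rel_fact l1 * rel_fact l2)%N.
Proof.
elim: l1 => [|x l1 IH] H /=; first by rewrite mul1n.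
rewrite IH => [|y z yl zl]; last by rewrite H // inE yl orbT.
rewrite mulnA count_cat (_ : count _ l2 = 0%N) ?addn0 //.
apply/eqP; rewrite -leqn0 leqNgt -has_count; apply/hasPn=> y.
by apply: H; rewrite inE eqxx.
Qed.

Hypothesis rR : reflexive r.
Hypothesis rS : symmetric r.
Hypothesis rT : transitive r.

(* The image of x ranges over its class in x :: l', and multiplication by a
   transposition moves it back to x. *)
Lemma card_rel_perm (l : seq T) : uniq l ->
  #|[pred s : {perm T} | perm_on [set x in l]%SET s & [forall x, r x (s x)]]| =
  rel_fact l.
Proof.
elim: l => [_|x l IH /andP[xl ul]] /=.
  rewrite -(card1 (1%g : {perm T})); apply: eq_card => s; rewrite !inE.
  apply/andP/eqP => [[s0 _]|->].
    by apply/permP=> x; rewrite perm1 (out_perm s0) // !inE.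
  by split; [exact: perm_on1 | apply/forallP=> x; rewrite perm1].
rewrite -IH // -sum1_card.
rewrite (partition_big (fun s : {perm T} => s x)
  (fun i => (i \in x :: l) && r x i)) /=; last first.
  move=> s /andP[sl /forallP-> ]; rewrite andbT.
  have := perm_closed x sl; by rewrite !inE eqxx.
rewrite (eq_bigr (fun=> #|[pred s : {perm T} | perm_on [set x in l]%SET s
    & [forall x, r x (s x)]]|)).
  rewrite sum_nat_const; congr (_ * _)%N.
  rewrite -[(_ + _)%N]/(count (r x) (x :: l)) -size_filter -(card_uniqP _).
    by apply: eq_card => i; rewrite mem_filter andbC.
  by rewrite filter_uniq //= xl.
move=> i /andP[il xi]; rewrite (reindex_inj (mulIg (tperm x i))) /= -sum1_card.
have rt y : r y (tperm x i y) by case: tpermP => [->|->|_ _]; rewrite // rS.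
have tl : perm_on [set y in x :: l]%SET (tperm x i).
  apply: subset_trans (tperm_on x i) _; apply/subsetP=> y.
  by rewrite !inE => /orP[]/eqP->; rewrite ?eqxx // -in_cons.
apply: eq_bigl => s; rewrite !inE permM.
have -> : (tperm x i (s x) == i) = (s x == x).
  by rewrite -(inj_eq (@perm_inj _ (tperm x i)) (s x) x) tpermL.
have -> : perm_on [set y in x :: l]%SET (s * tperm x i)%g =
    perm_on [set y in x :: l]%SET s.
  apply/idP/idP=> [H|/perm_onM->//].
  by have := perm_onM H tl; rewrite -mulgA tperm2 mulg1.
have -> : [forall y, r y ((s * tperm x i)%g y)] = [forall y, r y (s y)].
  apply: eq_forallb => y; rewrite permM; apply/idP/idP=> [H|/rT-> //].
  by apply: rT H _; rewrite rS.
(* Fixing [x] turns support in [x :: l] into support in [l]. *)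
rewrite andbAC; congr (_ && _); apply/andP/idP => [[sl /eqP sx]|sl].
  apply/subsetP=> y sy; have := subsetP sl y sy; rewrite !inE.
  by case/predU1P=> [yx|//]; move: sy; rewrite yx inE sx eqxx.
split; last by rewrite (out_perm sl) // inE.
by apply: subset_trans sl _; apply/subsetP=> y; rewrite !inE orbC => ->.
Qed.

End RelationPermutations.

(* The product of the factorials of the multiplicities of the letters of u. *)
Fixpoint mult_fact (u : seq nat) : nat :=
  if u is x :: v then (count_mem x u * mult_fact v)%N else 1%N.

Lemma rel_fact_map (T : finType) (r : rel T) (f : T -> nat) (l : seq T) :
  {in l &, forall x y, r x y = (f x == f y)} ->
  rel_fact r l = mult_fact (map f l).
Proof.
elim: l => [//|x l IH] H; have [xl ll] : x \in x :: l /\ {subset l <= x :: l}.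
  by split=> [|y yl]; rewrite inE ?eqxx ?yl ?orbT.
rewrite -[LHS]/(count (r x) (x :: l) * rel_fact r l)%N.
rewrite -[RHS]/(count_mem (f x) (map f (x :: l)) * mult_fact (map f l))%N.
rewrite IH => [|y z yl zl]; last by rewrite H // ll.
congr (_ * _)%N; rewrite count_map; apply: eq_in_count => y yl.
by rewrite H //= eq_sym.
Qed.

Lemma sum_count_mem_undup (s : seq nat) :
  (\sum_(x <- undup s) count_mem x s = size s)%N.
Proof.
rewrite -[RHS](perm_size (perm_count_undup s)) size_flatten sumnE !big_map.
by apply: eq_bigr => x _; rewrite size_nseq.
Qed.

(** Arrangements are grouped by first letter x. Its factor is the multiplicity of x in [s], whatever
    the tail; the tails give (size s - 1)! by induction, and the multiplicities add up to
    [size s]. *)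
Lemma sum_mult_fact (s : seq nat) :
  (\sum_(u <- permutations s) mult_fact u = (size s)`!)%N.
Proof.
move: {2}(size s) (erefl (size s)) => n; elim: n s => [|n IH] s sn.
  by rewrite (size0nil sn) big_seq1.
rewrite (perm_big _ (permutationsE _)) ?sn // big_allpairs_dep.
under eq_big_seq => x; first rewrite mem_undup => xs.
  rewrite (eq_big_seq (fun t => count_mem x s * mult_fact t)%N) => [|t]; last first.
    rewrite mem_permutations => ts.
    have /seq.permP/(_ (pred1 x)) <- : perm_eq (x :: t) s.
      by rewrite perm_sym (permPl (perm_to_rem xs)) perm_cons perm_sym.
    by [].
  rewrite -big_distrr /= IH; last by rewrite size_rem // sn.
  rewrite size_rem // sn.
over.
by rewrite -big_distrl /= sum_count_mem_undup sn factS.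
Qed.

(** * Letting the variables commute *)

Lemma seq_mset_eq (w : seq nat) (m : {mset nat}) :
  (seq_mset w == m) = perm_eq w m.
Proof.
by rewrite -[m]seq_mset_id; apply/eqP/idP => /eq_seq_msetP //; rewrite seq_mset_id.
Qed.

Lemma rho_seriesE (F : ncseries) m :
  rho_series F m = \sum_(w <- permutations m) F w.
Proof.
rewrite fsbig_seq ?permutations_uniq //; apply: eq_fsbigl.
apply/seteqP; split=> w /=; rewrite mem_permutations -seq_mset_eq.
  by move=> ->.
by move/eqP.
Qed.

Lemma rho_lin (a : rat) (F G : NCSym) : rho (a *: F + G) = a *: rho F + rho G.
Proof.
apply: val_inj; apply: funext => m /=.
change (rho_series (ncsym_val (a *: F + G)) m =
  a * rho_series (ncsym_val F) m + rho_series (ncsym_val G) m).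
by rewrite !rho_seriesE mulr_sumr -big_split.
Qed.

Lemma seq_mset_cat (u v : seq nat) :
  seq_mset (u ++ v) = msetD (seq_mset u) (seq_mset v) :> {mset nat}.
Proof. by apply/msetP=> x; rewrite msetE2 !mset_seqE count_cat. Qed.

Lemma size_seq_mset (u : seq nat) : size (seq_mset u) = size u.
Proof. exact: perm_size (perm_eq_seq_mset u). Qed.

(** Rearrangements of a monomial are grouped by the contents of their pieces before and after
    position k; as A lives on words of length k, the groups give the terms of the product. *)
Lemma rho_cat (k : nat) (A B : ncseries) : (forall w, size w != k -> A w = 0) ->
  rho_series (fun w => A (take k w) * B (drop k w)) =
  cmul (rho_series A) (rho_series B).
Proof.
move=> Ak; apply: funext => m.
pose phi w : {mset nat} * {mset nat} := (seq_mset (take k w), seq_mset (drop k w)).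
pose D := undup (map phi (permutations m)).
have rhoA0 (q : {mset nat}) : size q != k -> rho_series A q = 0.
  move=> qk; rewrite rho_seriesE big_seq big1 // => u.
  by rewrite mem_permutations => /perm_size uq; rewrite Ak // uq.
have phiD w : perm_eq w m -> msetD (phi w).1 (phi w).2 = m.
  by move=> wm; rewrite -seq_mset_cat cat_take_drop; apply/eqP; rewrite seq_mset_eq.
rewrite /cmul (@fsbigE _ _ _ _ _ D) ?undup_uniq //; first last.
(* If the first component had size k, concatenating the two enumerations would put the pair in [D];
   so A kills its term. *)
- move=> [a b] /= abm abD; rewrite rhoA0 ?mul0r //; apply: contra abD => /eqP ak.
  rewrite mem_undup; apply/mapP; exists (enum_mset a ++ enum_mset b).
    by rewrite mem_permutations -seq_mset_eq seq_mset_cat !seq_mset_id abm.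
  by rewrite /phi take_size_cat // drop_size_cat // !seq_mset_id.
- move=> q /=; rewrite mem_undup => /mapP[w]; rewrite mem_permutations => wm ->.
  exact: phiD.
rewrite rho_seriesE.
transitivity (\sum_(w <- permutations m) \sum_(q <- D | phi w == q)
    A (take k w) * B (drop k w)).
  rewrite !big_seq; apply: eq_bigr => w wm.
  rewrite big_mkcond (bigD1_seq (phi w)) /= ?undup_uniq //; last first.
    by rewrite mem_undup map_f.
  by rewrite eqxx big1 ?addr0 // => q; rewrite eq_sym => /negPf->.
rewrite (exchange_big_dep xpredT) //= big_seq [RHS]big_seq_cond.
apply: eq_big => [q|q].
  case: (boolP (q \in D)) => // qD /=; apply/esym; apply/mem_set => /=.
  move: qD; rewrite mem_undup => /mapP[w]; rewrite mem_permutations => wm ->.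
  exact: phiD.
move=> qD; rewrite !rho_seriesE mulr_suml.
under [RHS]eq_bigr do rewrite mulr_sumr.
(* Another size occurs when [m] has fewer than k letters; both sides are then 0. *)
have [q1k|q1k] := eqVneq (size (enum_mset q.1)) k; last first.
  rewrite big1_seq => [|w /andP[/eqP wq _]].
    rewrite big1_seq // => u /andP[_]; rewrite mem_permutations => /perm_size uq.
    by rewrite big1 // => v _; rewrite (Ak u) ?uq ?mul0r.
  by rewrite Ak ?mul0r // -size_seq_mset; rewrite -wq in q1k.
rewrite -big_filter.
(* The rearrangements with contents [q] are the concatenations of arrangements of its two
   components, each obtained once. *)
rewrite (perm_big [seq u ++ v | u <- permutations (enum_mset q.1),
                                v <- permutations (enum_mset q.2)]).
  rewrite big_allpairs_dep big_seq [RHS]big_seq; apply: eq_bigr => u.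
  rewrite mem_permutations => /perm_size uq; apply: eq_bigr => v _.
  by rewrite take_size_cat ?drop_size_cat ?uq.
apply: uniq_perm.
- by rewrite filter_uniq ?permutations_uniq.
- apply: allpairs_uniq; rewrite ?permutations_uniq // => -[u v] [u' v'] /=.
  case/allpairsP=> -[a b] /= []; rewrite !mem_permutations => /perm_size ua _ [-> _].
  case/allpairsP=> -[a' b'] /= []; rewrite !mem_permutations => /perm_size ua' _ [-> _].
  by move/eqP; rewrite eqseq_cat ?ua ?ua' // => /andP[/eqP-> /eqP->].
move=> w; rewrite mem_filter mem_permutations; apply/andP/allpairsP => [[/eqP wq wm]|].
  exists (take k w, drop k w); rewrite /= !mem_permutations -!seq_mset_eq -wq.
  by rewrite !eqxx cat_take_drop.
case=> -[u v] /= []; rewrite !mem_permutations -!seq_mset_eq => /eqP uq /eqP vq ->.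
have uk : size u = k by rewrite -q1k -uq size_seq_mset.
have phiq : phi (u ++ v) = q.
  by rewrite /phi take_size_cat // drop_size_cat // uq vq; case: (q).
split; first by rewrite phiq.
rewrite seq_mset_cat uq vq.
move: qD; rewrite mem_undup => /mapP[w']; rewrite mem_permutations => wm' ->.
exact/eqP/phiD.
Qed.

(** The word is cut into consecutive pieces of lengths [lam]. The size test rejects words that are
    too short, the final test those that are too long. *)
Fixpoint word_weight (g : seq nat -> rat) (lam : seq nat) (w : seq nat) : rat :=
  if lam is k :: lam' then
    ((size (take k w) == k)%:R * g (take k w)) * word_weight g lam' (drop k w)
  else (w == [::])%:R.

Lemma cmulZ (a b : rat) (F G : cseries) m :
  cmul (fun q => a * F q) (fun q => b * G q) m = a * b * cmul F G m.
Proof. by rewrite /cmul mulr_fsumr; apply: eq_fsbigr => q _; rewrite mulrACA. Qed.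

(** [rho_cat] peels off one piece at a time, and a piece of length k contributes k! u_k. *)
Lemma rho_word_weight (g : seq nat -> rat) (u : nat -> cseries) (lam : seq nat) :
  (forall k m, rho_series (fun w => (size w == k)%:R * g w) m = k`!%:R * u k m) ->
  forall m, rho_series (word_weight g lam) m =
    (\prod_(k <- lam) k`!)%N%:R * cprod u lam m.
Proof.
move=> gu; elim: lam => [|k lam IH] m /=.
  rewrite big_nil mul1r rho_seriesE /cone.
  have [->|m0] := eqVneq m mset0.
    by rewrite enum_mset0 big_seq1.
  rewrite big1_seq // => w /andP[_]; rewrite mem_permutations -seq_mset_eq => /eqP wm.
  case: eqP => // w0; case/eqP: m0; rewrite -wm w0.
  by apply/msetP=> x; rewrite mset_seqE mset0E.
rewrite (@rho_cat k (fun w => (size w == k)%:R * g w)) => [|w /negPf->]; last first.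
  by rewrite mul0r.
rewrite big_cons natrM -cmulZ; congr (cmul _ _ _); apply: funext => q.
  exact: gu.
exact: IH.
Qed.

(** A multiset of k distinct letters has k! arrangements, all duplicate-free; with a repetition none
    is. *)
Lemma rho_uniq k m :
  rho_series (fun w => (size w == k)%:R * (uniq w)%:R) m = k`!%:R * e_cseries k m.
Proof.
rewrite rho_seriesE e_cseriesE big_seq.
under eq_bigr => w.
  rewrite mem_permutations => wm; rewrite (perm_size wm) (perm_uniq wm) -natrM mulnb.
over.
rewrite -big_seq big_const_seq count_predT iter_addr_0.
case: andP => [[/eqP <- /size_permutations->]|_]; first by rewrite mulr1.
by rewrite mulr0 mul0rn.
Qed.

(** By [sum_mult_fact] the total weight is k! for every multiset of size k, with or without
    repetitions. *)
Lemma rho_mult_fact k m :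
  rho_series (fun w => (size w == k)%:R * (mult_fact w)%:R) m =
  k`!%:R * h_cseries k m.
Proof.
rewrite rho_seriesE h_cseriesE big_seq.
under eq_bigr => w.
  rewrite mem_permutations => /perm_size->.
over.
rewrite -big_seq -mulr_sumr -natr_sum sum_mult_fact mulrC.
by case: eqP => [->|_]; rewrite ?mulr0.
Qed.

(** * Reordering the positions of words *)

Section Reposition.
Variables (n : nat) (l : seq 'I_n).
Hypothesis lP : perm_eq l (enum 'I_n).

Definition reposition (w : seq nat) := [seq nth 0%N w (j : 'I_n) | j <- l].

Lemma perm_reposition w : size w = n -> perm_eq (reposition w) w.
Proof.
move=> wn; rewrite -[X in perm_eq _ X](ncmon_nth wn) /ncmon.
under eq_map do rewrite ffunE.
exact: perm_map.
Qed.

Lemma reposition_inj (v w : seq nat) : size v = n -> size w = n ->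
  reposition v = reposition w -> v = w.
Proof.
move=> vn wn /eq_in_map vw; rewrite -(ncmon_nth vn) -(ncmon_nth wn).
apply/eq_in_map => j _; rewrite !ffunE; apply: vw.
by rewrite (perm_mem lP) mem_enum.
Qed.

(** Reading the positions in another order permutes the arrangements of each multiset, so the sum
    over them is unchanged. *)
Lemma rho_reposition (F G : ncseries) m :
  (forall w, size w != n -> F w = 0) -> (forall w, size w != n -> G w = 0) ->
  (forall w, size w = n -> F w = G (reposition w)) ->
  rho_series F m = rho_series G m.
Proof.
move=> F0 G0 FG; rewrite !rho_seriesE.
have [mn|mn] := eqVneq (size m) n; last first.
  by rewrite !big1_seq // => w /andP[_]; rewrite mem_permutations => /perm_size wm;
    rewrite ?F0 ?G0 ?wm.
transitivity (\sum_(w <- map reposition (permutations m)) G w).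
  rewrite big_map big_seq [RHS]big_seq; apply: eq_bigr => w.
  by rewrite mem_permutations => /perm_size wm; rewrite FG // wm.
apply/perm_big; have sz w : w \in permutations m -> size w = n.
  by rewrite mem_permutations => /perm_size->.
have us : uniq (map reposition (permutations m)).
  rewrite map_inj_in_uniq ?permutations_uniq // => v w /sz vn /sz wn.
  exact: reposition_inj.
apply: uniq_perm; rewrite ?permutations_uniq //.
have sub : {subset map reposition (permutations m) <= permutations m}.
  move=> _ /mapP[w wm ->]; move: (sz w wm) => wn; move: wm.
  rewrite !mem_permutations; apply: perm_trans; exact: perm_reposition.
by have [|_ E] := uniq_min_size us sub; rewrite ?size_map.
Qed.

End Reposition.

(** * Images of the elementary and complete series *)

Lemma word_weight_size g lam w : size w != sumn lam -> word_weight g lam w = 0.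
Proof.
elim: lam w => [|k lam IH] w /=; first by rewrite -size_eq0 => /negPf->.
have [kw|_] := eqVneq (size (take k w)) k; last by rewrite !mul0r.
move=> wk; rewrite IH ?mulr0 //; apply: contra wk => /eqP dw.
by rewrite -[w in size w](cat_take_drop k) size_cat kw dw.
Qed.

Section Blocks.
Variables (n : nat) (P : {set {set 'I_n}}).
Hypothesis sP : setpart P.
Variable Bs : seq {set 'I_n}.
Hypothesis BsP : perm_eq Bs (enum P).

(** Listing positions block by block makes the blocks consecutive. [Bs] is an arbitrary enumeration
    of P, so that it can be sorted by size later. *)
Let pos := flatten [seq enum (B : {set 'I_n}) | B <- Bs].
Let lam := [seq #|(B : {set 'I_n})| | B <- Bs].

Lemma mem_blocks B : (B \in Bs) = (B \in P).
Proof. by rewrite (perm_mem BsP) mem_enum. Qed.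

Lemma perm_pos : perm_eq pos (enum 'I_n).
Proof.
have /and3P[/eqP cP tP _] := sP.
apply/allP=> j _ /=; rewrite count_flatten sumnE !big_map (perm_big _ BsP) big_enum /=.
have jP : j \in cover P by rewrite cP inE.
rewrite (bigD1 (pblock P j)) ?pblock_mem //= big1 => [|B /andP[BP Bj]].
  by rewrite !count_uniq_mem ?enum_uniq // !mem_enum mem_pblock jP.
rewrite count_uniq_mem ?enum_uniq // mem_enum; case: (boolP (j \in B)) => // jB.
by rewrite (def_pblock tP BP jB) eqxx in Bj.
Qed.

Lemma word_weight_blocks g (f : 'I_n -> nat) :
  word_weight g lam (map f pos) = \prod_(B <- Bs) g (map f (enum B)).
Proof.
rewrite /lam /pos; elim: Bs => [|B Cs IH] /=; first by rewrite big_nil.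
have sz : size (map f (enum B)) = #|B| by rewrite size_map -cardE.
by rewrite map_cat take_size_cat // drop_size_cat // sz eqxx mul1r IH big_cons.
Qed.

Lemma sumn_lam : sumn lam = n.
Proof.
rewrite -[RHS](size_enum_ord n) -(perm_size perm_pos) size_flatten /shape -map_comp.
by congr sumn; apply: eq_map => B /=; rewrite -cardE.
Qed.

Lemma e_series_blocks f :
  e_series P (ncmon f) = \prod_(B <- Bs) (uniq (map f (enum B)))%:R.
Proof.
rewrite e_seriesE //.
have -> : \prod_(B <- Bs) (uniq (map f (enum B)))%:R =
    (all (fun B : {set 'I_n} => uniq (map f (enum B))) Bs)%:R :> rat.
  elim: (Bs) => [|B Cs IH]; first by rewrite big_nil.
  by rewrite big_cons IH -natrM mulnb.
congr (nat_of_bool _)%:R; apply/'forall_forallP/allP => [H B|H j k].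
  rewrite mem_blocks => BP; apply/(dinjectiveP f B) => j k jB kB fjk.
  apply/eqP; apply: implyP (H j k) _; rewrite same_block_meet // fjk eqxx andbT.
  by apply/exists_inP; exists B; rewrite ?jB.
apply/implyP; rewrite same_block_meet //.
move=> /andP[/exists_inP[B BP /andP[jB kB]] /eqP fjk].
apply/eqP; have := H B; rewrite mem_blocks => /(_ BP)/(dinjectiveP f B); exact.
Qed.

(** The coefficient counts the permutations preserving the blocks of the meet. Points of different
    blocks of P are unrelated, so the count factors; inside a block the relation is equality of
    letters. *)
Lemma h_series_blocks f :
  h_series P (ncmon f) = \prod_(B <- Bs) (mult_fact (map f (enum B)))%:R.
Proof.
rewrite h_seriesE //; set Q := part_meet _ _.
have sQ : setpart Q by exact: setpart_meet.
have upos : uniq pos by rewrite (perm_uniq perm_pos) enum_uniq.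
have -> : #|[pred s | block_perm Q s]| = rel_fact (same_block Q) pos.
  rewrite -card_rel_perm //.
  - apply: eq_card => s; rewrite !inE; apply/esym/andb_idl => _.
    apply/subsetP=> j _; by rewrite inE (perm_mem perm_pos) mem_enum.
  - by move=> j; exact: same_block_refl.
  - by move=> j k; exact: same_block_sym.
  - exact: same_block_trans.
rewrite -natr_prod; congr _%:R; move: upos; rewrite /pos.
have : {subset Bs <= P} by move=> B; rewrite mem_blocks.
elim: (Bs) => [|B Cs IH] sub; first by rewrite big_nil.
have BP : B \in P by apply: sub; rewrite inE eqxx.
rewrite /= cat_uniq => /and3P[_ /hasPn BC uC].
rewrite big_cons rel_fact_cat => [|x y].
  rewrite IH // => [|C CC]; last by apply: sub; rewrite inE CC orbT.
  congr (_ * _)%N; apply: rel_fact_map => x y; rewrite !mem_enum => xB yB.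
  rewrite same_block_meet // andb_idl // => _.
  by apply/exists_inP; exists B; rewrite ?xB.
rewrite mem_enum => xB yC; rewrite same_block_meet // negb_and; apply/orP; left.
apply: contra (BC y yC) => xy; rewrite mem_enum (mem_setpart sP BP xB) inE.
exact: xy.
Qed.

(** Shared by e and h: after reordering, the product over blocks becomes [word_weight]. *)
Lemma rho_blocks (F : ncseries) (g : seq nat -> rat) (u : nat -> cseries) m :
  (forall w, size w != n -> F w = 0) ->
  (forall f : {ffun 'I_n -> nat}, F (ncmon f) = \prod_(B <- Bs) g (map f (enum B))) ->
  (forall k q, rho_series (fun w => (size w == k)%:R * g w) q = k`!%:R * u k q) ->
  rho_series F m = (\prod_(k <- lam) k`!)%N%:R * cprod u lam m.
Proof.
move=> F0 FB gu; rewrite -(rho_word_weight _ gu).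
apply: (rho_reposition perm_pos) => // w wn.
  by rewrite word_weight_size // sumn_lam.
rewrite -{1}(ncmon_nth wn) FB /reposition word_weight_blocks.
by apply: eq_bigr => B _; congr g; apply: eq_map => j; rewrite ffunE.
Qed.

Lemma rho_e_nc : rho (e_nc P) = (\prod_(k <- lam) k`!)%N%:R *: e_sym lam.
Proof.
apply: val_inj; apply: funext => m; apply: rho_blocks rho_uniq => [w wn|f].
  by rewrite /= /e_series monsum_size.
exact: e_series_blocks.
Qed.

Lemma rho_h_nc : rho (h_nc P) = (\prod_(k <- lam) k`!)%N%:R *: h_sym lam.
Proof.
apply: val_inj; apply: funext => m; apply: rho_blocks rho_mult_fact => [w wn|f].
  exact: h_series_size.
exact: h_series_blocks.
Qed.

End Blocks.

Lemma rho_e_h_nc n (P : {set {set 'I_n}}) : setpart P ->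
  exists (lam : seq nat) (c : rat),
    [/\ intpart lam, rho (e_nc P) = c *: e_sym lam & rho (h_nc P) = c *: h_sym lam].
Proof.
(* Sorting by decreasing size makes the block sizes an integer partition, where the ordinary
   involution is prescribed. *)
move=> sP; pose ge_card (A B : {set 'I_n}) := (#|B| <= #|A|)%N.
have BsP : perm_eq (sort ge_card (enum P)) (enum P) by rewrite perm_sort.
exists [seq #|B| | B : {set 'I_n} <- sort ge_card (enum P)].
exists (\prod_(k <- [seq #|B| | B : {set 'I_n} <- sort ge_card (enum P)]) k`!)%N%:R.
split; [|exact: rho_e_nc|exact: rho_h_nc].
apply/andP; split.
  by rewrite sorted_map; apply: sort_sorted => A B; exact: leq_total.
apply/allP=> _ /mapP[B + ->]; rewrite mem_sort mem_enum card_gt0 => BP.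
by have /and3P[_ _] := sP; apply: contraNneq => <-.
Qed.

(** * Involution, eigenvectors and compatibility with [rho] *)

Theorem theorem3p5
  (omega : {linear NCSym -> NCSym})
  (omega_e : forall (n : nat) (P : {set {set 'I_n}}),
     setpart P -> omega (e_nc P) = h_nc P)
  (omegaS : {linear Sym -> Sym})
  (omegaS_e : forall lam : seq nat, intpart lam -> omegaS (e_sym lam) = h_sym lam) :
  [/\ involutive omega,
      forall (n : nat) (P : {set {set 'I_n}}), setpart P ->
        p_nc P != 0 /\ omega (p_nc P) = part_sign P *: p_nc P
    & forall F : NCSym, omegaS (rho F) = rho (omega F)].
Proof.
have omega_p n (P : {set {set 'I_n}}) : setpart P ->
    omega (p_nc P) = part_sign P *: p_nc P.
  by apply: omega_p_nc => Q; exact: omega_e.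
split=> [|n P sP|].
(* Being fixed by the square of [omega] is a linear condition, so it is checked on power sums, where
   the sign squares to 1. *)
- apply: span_p => [|a F G FE GE|n P sP]; first by rewrite !linear0.
    by rewrite !linearP FE GE.
  by rewrite omega_p // linearZ /= omega_p // scalerA part_sign_sqr // scale1r.
- by split; [exact: p_nc_neq0 | exact: omega_p].
have rho0 : rho 0 = 0.
  by have := rho_lin (-1) 0 0; rewrite scaler0 addr0 scaleN1r addNr.
pose K F := omegaS (rho F) = rho (omega F).
have K0 : K 0 by rewrite /K !linear0 rho0 linear0.
have Klin a F G : K F -> K G -> K (a *: F + G).
  by rewrite /K => FE GE; rewrite linearP !rho_lin linearP FE GE.
(* The condition passes from the e_P to the p_P and from these to all of [NCSym]. *)
apply: (@span_p K) => // n; apply: (@span_e_p K) => // P sP.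
have [lam [c [lamP eE hE]]] := rho_e_h_nc sP.
by rewrite /K omega_e // eE hE linearZ /= omegaS_e.
Qed.
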